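(* Let $A=\{a_1<a_2<\dots<a_n<\dots\}$ be an infinite subset of $\mathbb{N}=\{1,2,\dots\}$, let $g_n=a_{n+1}-a_n$, and let $\alpha\ge1$ be a real number. Suppose that for all $n\ge 1$ $$\frac{g_n}{a_n}\ge\frac{\alpha}{n}(1+e_n),$$ where $(e_n)_{n=1}^\infty$ is a real sequence with $\lim_{n\to\infty}e_n=0$. Then $$\overline{\varepsilon}(A)\le\frac1\alpha.$$
   Context: For an infinite set $A\subseteq\mathbb{N}$ and real $x$, let $A(x)=|A\cap[1,x]|$. The upper exponential density of $A$ is $\overline{\varepsilon}(A)=\limsup_{k\to\infty}\frac{\log A(k)}{\log k}$. If $A=\{a_1<a_2<\dots\}$, then equivalently $\overline{\varepsilon}(A)=\limsup_{n\to\infty}\frac{\log n}{\log a_n}$. *)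

(* Defs.v *)
From mathcomp Require Import all_boot all_order all_algebra finmap.
From mathcomp Require Import all_classical all_reals all_analysis.
Set Implicit Arguments.
Unset Strict Implicit.
Unset Printing Implicit Defensive.
Import Order.TTheory GRing.Theory Num.Theory.
Import numFieldNormedType.Exports.
Local Open Scope classical_set_scope.
Local Open Scope ring_scope.

(* A(x) = |A `&` [1, x]| for real x. The intersection is always finite, so
   [fset_set] is the genuine finite set here and not its default value. *)
Definition count_upto (R : realType) (A : set nat) (x : R) : nat :=
  #|` fset_set (A `&` [set k : nat | (1 <= k)%N /\ k%:R <= x])|.

(* The terms where log A(k) or 1 / log k is meaningless (k <= 1 or A(k) = 0)
   are finitely many for infinite A, hence irrelevant to the limsup. *)
Definition upper_exp_density (R : realType) (A : set nat) : \bar R :=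
  limn_esup (fun k : nat => (ln (count_upto A (k%:R : R))%:R / ln k%:R)%:E).

(* A = {a_1 < a_2 < ...}: indices start at 1, the value [a 0] is unused. *)
Definition increasing_enumeration (A : set nat) (a : nat -> nat) : Prop :=
  (forall m n : nat, (0 < m)%N -> (m < n)%N -> (a m < a n)%N) /\
  A = [set a n | n in [set n : nat | (0 < n)%N]].

(* Main.v *)
Require Import Defs.
From mathcomp Require Import all_boot all_order all_algebra finmap.
From mathcomp Require Import all_classical all_reals all_analysis.
From mathcomp Require Import ring lra.
Import Order.TTheory GRing.Theory Num.Theory.
Import numFieldNormedType.Exports.
Local Open Scope classical_set_scope.
Local Open Scope ring_scope.

(** The gap condition says that [a n.+1 / a n >= 1 + alpha (1 + e n) / n].
    Fix [0 < gamma < alpha].  Since [alpha (1 + e n)] tends to [alpha], for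
    large [n] the logarithm of this ratio is at least
    [gamma / n >= gamma (ln n.+1 - ln n)], so [ln (a n) - gamma ln n] is
    eventually nondecreasing and hence bounded below: [a n] grows at least like
    [n ^ gamma] up to a constant factor ([growth_of_gap]).  The set [A] has
    exactly [m = A(k)] elements up to [k], so [a m <= k]
    ([enum_count_upto_le]), and the growth bound at [m] reads
    [ln A(k) <= (ln k + C) / gamma].  Dividing by [ln k], which tends to
    infinity, bounds the upper density by every number above [1 / gamma];
    letting [gamma] tend to [alpha] concludes. *)

Lemma limn_esup_le_near (R : realType) (u : nat -> \bar R) (x : \bar R) :
  (\forall k \near \oo, (u k <= x)%E) -> (limn_esup u <= x)%E.
Proof.
move=> ux; rewrite /limn_esup /limf_esup.
have : (ereal_sup [set u k | k in [set k | (u k <= x)%E]] <= x)%E.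
  by apply: ge_ereal_sup => _ [k /= ukx <-].
by apply: le_trans; apply: ereal_inf_lbound; exists [set k | (u k <= x)%E].
Qed.

(** Otherwise all elements of [A] up to [x] would be among the first [m - 1]
    terms, where [m] is their number. *)
Lemma enum_count_upto_le (R : realType) (A : set nat) (a : nat -> nat) (x : R) :
  increasing_enumeration A a -> (0 < count_upto A x)%N ->
  (a (count_upto A x))%:R <= x.
Proof.
move=> [a_incr A_im] m_gt0; rewrite leNgt; apply/negP => x_lt.
set m := count_upto A x in m_gt0 x_lt *.
pose F : {fset nat} := [fset a i | i in iota 1 m.-1]%fset.
have sub : A `&` [set k : nat | (1 <= k)%N /\ k%:R <= x] `<=` [set` F].
  rewrite A_im => _ [[i i_gt0 <-] [_ aix]] /=.
  apply/imfsetP; exists i => //=; rewrite mem_iota i_gt0 /= add1n prednK //.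
  rewrite ltnNge; apply/negP; rewrite leq_eqVlt => /predU1P[mi|/(a_incr _ _ m_gt0) ai].
    by move: x_lt; rewrite mi ltNge aix.
  by have := le_lt_trans aix x_lt; rewrite ltr_nat ltnNge (ltnW ai).
have finF : finite_set [set` F] by exact: finite_fset.
have := sub; rewrite fset_set_sub //; last exact: sub_finite_set finF.
rewrite set_fsetK => /fsubset_leq_card; rewrite -/(count_upto A x) -/m.
have : (#|` F| <= m.-1)%N.
  apply: leq_trans (leq_imfset_card _ _ _) _.
  by rewrite -[leqRHS](size_iota 1) size_undup.
by move=> /[swap] /leq_trans /[apply]; rewrite -ltnS prednK // ltnn.
Qed.

Lemma ln1D_ge (R : realType) (x : R) : 0 <= x -> x / (1 + x) <= ln (1 + x).
Proof.
move=> x_ge0; have x1_gt0 : 0 < 1 + x by lra.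
rewrite -lerN2 -lnV ?posrE //.
rewrite [in leLHS](_ : (1 + x)^-1 = 1 + - (x / (1 + x))); last by field; lra.
apply: le_ln1Dx; rewrite ltrN2 ltr_pdivrMr //; lra.
Qed.

(** The difference [beta - gamma] absorbs the second-order error in
    [ln (1 + beta / n)]. *)
Lemma ln_ratio_ge (R : realType) (beta gamma : R) (n : nat) (u : R) :
  (0 < n)%N -> 0 <= gamma -> 0 <= beta ->
  gamma * (n%:R + beta) <= beta * n%:R -> 1 + beta / n%:R <= u ->
  gamma * (ln n.+1%:R - ln n%:R) <= ln u.
Proof.
move=> n_gt0 gamma_ge0 beta_ge0 n_large u_ge.
have n0 : 0 < n%:R :> R by rewrite ltr0n.
have bn : 0 <= beta / n%:R by rewrite divr_ge0 // ltW.
have ln_step : ln n.+1%:R - ln n%:R <= n%:R^-1 :> R.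
  rewrite -ln_div ?posrE ?ltr0n //.
  have -> : n.+1%:R / n%:R = 1 + n%:R^-1 :> R by rewrite -natr1; field; lra.
  by apply: le_ln1Dx; rewrite (lt_trans _ (_ : 0 < _)) ?invr_gt0 //; lra.
have ln_u : ln (1 + beta / n%:R) <= ln u.
  by rewrite ler_ln ?posrE //; lra.
apply: le_trans _ ln_u; apply: le_trans _ (ln1D_ge _ _ bn).
have -> : beta / n%:R / (1 + beta / n%:R) = beta / (n%:R + beta).
  by field; rewrite !gt_eqF //; lra.
apply: le_trans (ler_wpM2l gamma_ge0 ln_step) _.
rewrite ler_pdivlMr; last lra.
by rewrite -mulrA mulrCA mulrC ler_pdivrMr.
Qed.

(** The constant is [gamma * ln N], where [N] is a rank from which
    [ln (a n) - gamma * ln n] is nondecreasing; it also covers the ranks below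
    [N] because there [ln (a n) >= 0]. *)
Lemma growth_of_gap (R : realType) (a : nat -> nat) (alpha gamma : R)
    (e : nat -> R) :
  (forall n : nat, (0 < n)%N -> (0 < a n)%N) -> 0 < gamma < alpha ->
  e n @[n --> \oo] --> (0 : R) ->
  (forall n : nat, (0 < n)%N ->
    ((a n.+1)%:R - (a n)%:R) / (a n)%:R >= alpha / n%:R * (1 + e n)) ->
  exists C : R, forall n : nat, (0 < n)%N ->
    gamma * ln n%:R <= ln (a n)%:R + C.
Proof.
move=> a_gt0 /andP[gamma_gt0 gamma_lt] e_lim gap.
pose beta := (gamma + alpha) / 2.
have gb : gamma < beta by rewrite /beta; lra.
have ba : beta < alpha by rewrite /beta; lra.
have e_near : \forall n \near \oo, beta / alpha - 1 <= e n.
  by apply: (cvgr_ge _ e_lim); rewrite subr_lt0 ltr_pdivrMr; lra.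
have n_near : \forall n \near \oo, gamma * beta / (beta - gamma) <= n%:R.
  exact: nbhs_infty_ger.
have [N _ NP] : \forall n \near \oo, [/\ (0 < n)%N,
    beta / alpha - 1 <= e n & gamma * beta / (beta - gamma) <= n%:R].
  near=> n; split; last 2 first.
  - by near: n.
  - by near: n.
  - by near: n; exact: nbhs_infty_gt.
have N_gt0 : (0 < N)%N by have [] := NP N (leqnn N).
have ln_a_ge0 n : (0 < n)%N -> 0 <= ln (a n)%:R :> R.
  by move=> n0; rewrite ln_ge0 // ler1n a_gt0.
have step n : (N <= n)%N ->
    gamma * (ln n.+1%:R - ln n%:R) <= ln (a n.+1)%:R - ln (a n)%:R :> R.
  move=> /NP[n0 en nn].
  have an0 : 0 < (a n)%:R :> R by rewrite ltr0n a_gt0.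
  have n0R : 0 < n%:R :> R by rewrite ltr0n.
  rewrite -[leRHS]ln_div ?posrE ?ltr0n ?a_gt0 //.
  apply: (ln_ratio_ge _ beta) => //; [lra|lra| |].
    move: nn; rewrite ler_pdivrMr; last lra.
    lra.
  have -> : (a n.+1)%:R / (a n)%:R
      = 1 + ((a n.+1)%:R - (a n)%:R) / (a n)%:R :> R by field; lra.
  rewrite lerD2l; apply: le_trans _ (gap n n0).
  rewrite [leRHS]mulrAC ler_pM2r ?invr_gt0 //.
  by rewrite -ler_pdivrMl; lra.
exists (gamma * ln N%:R).
elim=> // n IH _; have [nN|Nn] := leqP n.+1 N.
  apply: ler_wpDl; first exact: ln_a_ge0.
  by rewrite ler_wpM2l ?ler_ln ?posrE ?ltr0n ?ler_nat // ltW.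
have := IH (leq_trans N_gt0 Nn); have := step n Nn; lra.
Unshelve. all: by end_near. Qed.

Theorem theorem3p13 (R : realType) (A : set nat) (a : nat -> nat)
    (alpha : R) (e : nat -> R)
    (A_pos : forall k : nat, A k -> (1 <= k)%N)
    (A_inf : infinite_set A)
    (A_enum : increasing_enumeration A a)
    (alpha_ge1 : 1 <= alpha)
    (e_lim : e n @[n --> \oo] --> (0 : R))
    (gap_ge : forall n : nat, (1 <= n)%N ->
      ((a n.+1)%:R - (a n)%:R) / (a n)%:R >= alpha / n%:R * (1 + e n)) :
  (upper_exp_density R A <= (1 / alpha)%:E)%E.
Proof.
have a_gt0 n : (0 < n)%N -> (0 < a n)%N.
  by move=> n0; apply: A_pos; rewrite (proj2 A_enum); exists n.
apply/lee_addgt0Pr => eps eps_gt0; rewrite -EFinD.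
(* Half of [eps] pays for replacing [alpha] by [gamma], the other half for
   the additive constant of the growth bound. *)
pose delta := 1 / alpha + eps / 2.
have alpha_gt0 : 0 < alpha by lra.
have ialpha_gt0 : 0 < 1 / alpha by rewrite divr_gt0.
have delta_gt0 : 0 < delta by rewrite /delta; lra.
have gamma_bounds : 0 < delta^-1 < alpha.
  rewrite invr_gt0 delta_gt0 /= invf_plt ?posrE //.
  by rewrite /delta div1r; lra.
have [C growth] := growth_of_gap _ _ _ _ _ a_gt0 gamma_bounds e_lim gap_ge.
apply: limn_esup_le_near.
have k_large : \forall k \near \oo, expR (2 * delta * `|C| / eps) <= k%:R :> R.
  exact: nbhs_infty_ger.
near=> k; rewrite lee_fin.
have k_gt1 : (1 < k)%N by near: k; exact: nbhs_infty_gt.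
have kR_gt0 : 0 < k%:R :> R by rewrite ltr0n ltnW.
have lnk_gt0 : 0 < ln k%:R :> R by rewrite ln_gt0 // ltr1n.
rewrite ler_pdivrMr //.
have [->|m_gt0] := posnP (count_upto A (k%:R : R)).
  by rewrite ln0 // mulr_ge0 ?ltW //; lra.
have am_le := enum_count_upto_le _ _ _ _ A_enum m_gt0.
set m := count_upto A _ in m_gt0 am_le *.
have ln_am : ln (a m)%:R <= ln k%:R :> R.
  by rewrite ler_ln ?posrE // ltr0n a_gt0.
have ln_m : ln m%:R <= delta * (ln k%:R + C).
  by rewrite -ler_pdivrMl //; have := growth m m_gt0; lra.
have lnk_large : delta * `|C| <= eps / 2 * ln k%:R.
  have : 2 * delta * `|C| / eps <= ln k%:R.
    rewrite -(expRK (2 * delta * `|C| / eps)) ler_ln ?posrE ?expR_gt0 //.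
    by near: k.
  by rewrite ler_pdivrMr //; lra.
have CC : delta * C <= delta * `|C| by rewrite ler_pM2l // ler_norm.
have -> : 1 / alpha + eps = delta + eps / 2 by rewrite /delta; lra.
lra.
Unshelve. all: by end_near. Qed.
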